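(* Let $p\ge3$, $D=\operatorname{diag}(d_1,\ldots,d_p)$ with $d_j>0$, and $\Gamma=\operatorname{diag}(\gamma_1,\ldots,\gamma_p)$ with $\gamma_j\ge0$, with indices sorted so that $d_1^2/(d_1+\gamma_1)\ge d_2^2/(d_2+\gamma_2)\ge\cdots\ge d_p^2/(d_p+\gamma_p)$. Consider the problem \[ \max_{A}\; c^*(D,A)=\sum_{j=1}^p d_ja_j-2\max_{j=1,\ldots,p} d_ja_j \] over diagonal matrices $A=\operatorname{diag}(a_1,\ldots,a_p)$ with $a_j\ge0$ ($j=1,\ldots,p$) and $\sum_{j=1}^p(d_j+\gamma_j)a_j^2=\sum_{j=1}^p d_j^2/(d_j+\gamma_j)$ (this constraint set is nonempty, containing $a_j=d_j/(d_j+\gamma_j)$). Then: (i) there exists a unique solution $A^\dagger=\operatorname{diag}(a_1^\dagger,\ldots,a_p^\dagger)$ to this problem; (ii) letting $\nu$ be the largest index such that $d_\nu a_\nu^\dagger=\max(d_1a_1^\dagger,\ldots,d_pa_p^\dagger)$, we have $\nu\ge3$, $d_1a_1^\dagger=\cdots=d_\nu a_\nu^\dagger>d_ja_j^\dagger$ for $j\ge\nu+1$, and \[ a_j^\dagger=K_\nu\Big(\sum_{k=1}^\nu\frac{d_k+\gamma_k}{d_k^2}\Big)^{-1}\frac{\nu-2}{d_j}\ (j=1,\ldots,\nu),\qquad a_j^\dagger=K_\nu\frac{d_j}{d_j+\gamma_j}\ (j=\nu+1,\ldots,p), \] where $K_\nu=\{\sum_{j=1}^p d_j^2/(d_j+\gamma_j)\}^{1/2}M_\nu^{-1/2}$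 and \[ M_\nu=\frac{(\nu-2)^2}{\sum_{j=1}^\nu (d_j+\gamma_j)/d_j^2}+\sum_{j=\nu+1}^p\frac{d_j^2}{d_j+\gamma_j}; \] the achieved maximum value is $c^*(D,A^\dagger)=K_\nu M_\nu>0$; (iii) if $X\sim N_p(\theta,D)$ with unknown $\theta\in\mathbb R^p$, then the estimator $\delta_{A^\dagger}(X)=X-\frac{c^*(D,A^\dagger)}{X^\top A^{\dagger\top}A^\dagger X}A^\dagger X$ is minimax under the loss $\|\delta-\theta\|^2$.
   Context: An empty sum is $0$. An estimator $\delta$ of $\theta$ is minimax (under squared Euclidean loss) if $E_\theta\|\delta(X)-\theta\|^2\le\operatorname{tr}(D)=\sum_j d_j$ for all $\theta\in\mathbb R^p$. *)

(* Defs.v *)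
From HB Require Import structures.
From mathcomp Require Import all_boot all_order all_algebra.
From mathcomp Require Import all_classical all_reals all_analysis.
Set Implicit Arguments. Unset Strict Implicit. Unset Printing Implicit Defensive.
Import Order.TTheory GRing.Theory Num.Theory.
Import numFieldNormedType.Exports.
Local Open Scope ring_scope.

Section Defs.
Variable R : realType.

(* c^*(D,A) = sum_j d_j a_j - 2 max_j d_j a_j  (indices 0..p-1).
   The max is taken as \big[Num.max/0]; on feasible A (a_j >= 0, d_j > 0)
   all d_j a_j >= 0 so this is exactly max_j d_j a_j. *)
Definition cstar (p : nat) (d a : 'I_p -> R) : R :=
  \sum_(j < p) d j * a j - 2 * \big[Num.max/0]_(j < p) (d j * a j).

Definition feasible (p : nat) (d g a : 'I_p -> R) : Prop :=
  (forall j, 0 <= a j) /\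
  \sum_(j < p) (d j + g j) * a j ^+ 2 = \sum_(j < p) d j ^+ 2 / (d j + g j).

Definition is_solution (p : nat) (d g a : 'I_p -> R) : Prop :=
  feasible d g a /\ forall b, feasible d g b -> cstar d b <= cstar d a.

Definition estimator (p : nat) (d a : 'I_p -> R) (x : 'I_p -> R) : 'I_p -> R :=
  fun j => x j - cstar d a / (\sum_(k < p) (a k * x k) ^+ 2) * (a j * x j).

Definition gauss_pdf (m v x : R) : R :=
  expR (- ((x - m) ^+ 2) / (2 * v)) / Num.sqrt (2 * pi * v).

Fixpoint iter_int (n : nat) (f : (nat -> R) -> \bar R) : \bar R :=
  match n with
  | 0 => f (fun _ => 0)
  | n'.+1 => (\int[lebesgue_measure]_(t in [set: R])
                iter_int n' (fun y => f (fun k => if k == n' then t else y k)))%E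
  end.

Definition restr (p : nat) (x : nat -> R) : 'I_p -> R := fun j => x (val j).

Definition risk (p : nat) (d : 'I_p -> R) (delta : ('I_p -> R) -> ('I_p -> R))
    (theta : 'I_p -> R) : \bar R :=
  iter_int p (fun x =>
    ((\sum_(j < p) (delta (@restr p x) j - theta j) ^+ 2) *
     \prod_(j < p) gauss_pdf (theta j) (d j) (x j))%:E).

Definition minimax (p : nat) (d : 'I_p -> R)
    (delta : ('I_p -> R) -> ('I_p -> R)) : Prop :=
  forall theta : 'I_p -> R, (risk d delta theta <= (\sum_(j < p) d j)%:E)%E.

End Defs.

(* Main.v *)
Require Import Defs.
From HB Require Import structures.
From mathcomp Require Import all_boot all_order all_algebra.
From mathcomp Require Import all_classical all_reals all_analysis measurable_realfun.
From mathcomp Require Import ring lra.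
Import Order.TTheory GRing.Theory Num.Theory.
Import numFieldNormedType.Exports.
Local Open Scope ring_scope.

(* Put w_j = (d_j + g_j) / d_j^2 and y_j = d_j a_j.  For weights v_j <= 1 with
   sum_j (1 - v_j) = 2 every y satisfies sum_j y_j - 2 max_j y_j <= sum_j v_j y_j;
   choosing v_j = w_j min(1 / w_j, mu), where the water level mu makes these
   weights sum to p - 2, Cauchy-Schwarz on the ellipsoid of feasible points
   singles out y_j proportional to min(1 / w_j, mu), and the Cauchy-Schwarz
   defect gives uniqueness.

   Minimaxity is Stein's argument, applied to the smooth shrinkage
   c A x / (|A x|^2 + e): its coordinates and their partial derivatives are
   bounded, so Stein's identity needs no integrability of 1 / |A x|^2, and
   Fatou's lemma carries the risk bound to e = 0. *)

(** * The optimal weights *)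

Section WaterLevel.
Variables (R : realType) (p : nat) (w : 'I_p -> R).
Hypotheses (p3 : (3 <= p)%N) (w_gt0 : forall j, 0 < w j)
  (w_mono : forall i j : 'I_p, (i <= j)%N -> w i <= w j).

Let T n := \sum_(k < p | (k < n)%N) w k.

(** With [mu = (nu - 2) / T nu], the inequalities say that [mu <= 1 / w j] below [nu] and
    [1 / w j < mu] from [nu] on. The largest [nu] with the first property also has the second, since
    otherwise [nu + 1] would qualify. *)
Lemma water_level : exists nu : nat, [/\ (3 <= nu <= p)%N,
  forall j : 'I_p, (j < nu)%N -> (nu%:R - 2) * w j <= T nu &
  forall j : 'I_p, (nu <= j)%N -> T nu < (nu%:R - 2) * w j].
Proof.
pose P n := (3 <= n <= p)%N &&
  [forall j : 'I_p, (j < n)%N ==> ((n%:R - 2) * w j <= T n)].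
have P3 : P 3%N.
  rewrite /P p3 /=; apply/forallP => j; apply/implyP => j3.
  (* At [n = 3] the factor is [1], and [w j] is one of the positive terms of [T 3]. *)
  rewrite (_ : 3%:R - 2 = 1 :> R) ?mul1r; last by lra.
  rewrite /T (bigD1 j)//= lerDl; apply: sumr_ge0 => i _; exact: ltW.
have Pp n : P n -> (n <= p)%N by case/andP => /andP[].
case: (ex_maxnP (ex_intro P _ P3) Pp) => nu /andP[nu3p /forallP Pnu] nu_max.
exists nu; split=> // [j jnu|j nuj]; first by have /implyP := Pnu j; apply.
rewrite ltNge; apply/negP => wj.
have nup : (nu < p)%N by exact: leq_ltn_trans nuj (ltn_ord j).
pose i := Ordinal nup.
have nu2 : 0 <= nu%:R - 2 :> R.
  by rewrite subr_ge0 ler_nat; case/andP: nu3p => /ltnW.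
(* Since [w] increases, a failure at some [j >= nu] is also a failure at the index [nu] itself. *)
have wi : (nu%:R - 2) * w i <= T nu.
  by apply: le_trans wj; rewrite ler_wpM2l// w_mono.
have TS : T nu.+1 = T nu + w i.
  rewrite /T (bigD1 i)//= addrC; congr (_ + _); apply: eq_bigl => k.
  by rewrite ltnS -val_eqE /= andbC -ltn_neqAle.
(* For [k <= nu]: [(nu - 1) w k <= (nu - 2) w i + w i <= T nu + w i = T nu.+1]. *)
have : P nu.+1.
  rewrite /P nup; case/andP: (nu3p) => /leqW -> _ /=.
  apply/forallP => k; apply/implyP => knu.
  have wk : w k <= w i by rewrite w_mono.
  rewrite TS -[nu.+1]addn1 natrD.
  have := ler_wpM2l nu2 wk; lra.
by move/nu_max; rewrite ltnn.
Qed.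

End WaterLevel.

(** * The maximiser in closed form *)

Section Optimum.
Variables (R : realType) (p : nat) (d g : 'I_p -> R).
Hypotheses (p3 : (3 <= p)%N) (d_gt0 : forall j, 0 < d j)
  (g_ge0 : forall j, 0 <= g j)
  (d_sort : forall i j : 'I_p, (i <= j)%N ->
     d j ^+ 2 / (d j + g j) <= d i ^+ 2 / (d i + g i)).

Let S := \sum_(j < p) d j ^+ 2 / (d j + g j).
Let T nu := \sum_(k < p | (k < nu)%N) (d k + g k) / d k ^+ 2.
Let M nu := (nu%:R - 2) ^+ 2 / T nu
            + \sum_(j < p | (nu <= j)%N) d j ^+ 2 / (d j + g j).
Let K nu := Num.sqrt S / Num.sqrt (M nu).

(** The last clause is optimality with a quadratic defect: its right side is nonpositive and
    vanishes only at [b = a], so it gives both maximality and uniqueness. *)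
Lemma optimum : exists (a : 'I_p -> R) (nu : nat) (m : R),
  m = \big[Num.max/0]_(j < p) (d j * a j) /\
  (3 <= nu <= p)%N /\
  (forall j : 'I_p, (j < nu)%N -> d j * a j = m) /\
  (forall j : 'I_p, (nu <= j)%N -> d j * a j < m) /\
  (forall j : 'I_p, (j < nu)%N -> a j = K nu * (T nu)^-1 * (nu%:R - 2) / d j) /\
  (forall j : 'I_p, (nu <= j)%N -> a j = K nu * (d j / (d j + g j))) /\
  (cstar d a = K nu * M nu /\ 0 < cstar d a) /\
  feasible d g a /\
  exists2 k : R, 0 < k & forall b, feasible d g b ->
    k * (cstar d b - cstar d a)
      <= - \sum_(j < p) (d j + g j) * (b j - a j) ^+ 2.
Proof.
have dg0 j : 0 < d j + g j by rewrite ltr_wpDr.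
have d2 j : 0 < d j ^+ 2 by rewrite exprn_gt0.
pose w j := (d j + g j) / d j ^+ 2.
have w0 j : 0 < w j by rewrite divr_gt0.
have qE j : d j ^+ 2 / (d j + g j) = (w j)^-1 by rewrite invf_div.
have w_mono (i j : 'I_p) : (i <= j)%N -> w i <= w j.
  by move=> /d_sort; rewrite !qE lef_pV2 ?posrE.
have [nu [nu3p wle wgt]] := water_level _ _ _ p3 w0 w_mono.
have T0 : 0 < T nu.
  rewrite /T; case/andP: (nu3p) => nu3 nup.
  rewrite (bigD1 (Ordinal (leq_trans (ltn0Sn 2) p3)))/=; last exact: leq_trans nu3.
  apply: ltr_pwDl; first exact: w0.
  by apply: sumr_ge0 => j _; exact: ltW (w0 j).
have nu2 : 0 < nu%:R - 2 :> R by rewrite subr_gt0 ltr_nat; case/andP: nu3p.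
have M0 : 0 < M nu.
  rewrite /M ltr_pwDl ?divr_gt0 ?exprn_gt0// sumr_ge0// => j _.
  by rewrite divr_ge0 ?ltW.
have S0 : 0 < S.
  rewrite /S (bigD1 (Ordinal (leq_trans (ltn0Sn 2) p3)))//=.
  by rewrite ltr_pwDl ?divr_gt0// sumr_ge0// => j _; rewrite divr_ge0 ?ltW.
have K0 : 0 < K nu by rewrite divr_gt0 ?sqrtr_gt0.
have K2M : K nu ^+ 2 * M nu = S.
  by rewrite expr_div_n !sqr_sqrtr ?ltW// divfK ?gt_eqF.
pose mu := (nu%:R - 2) / T nu.
have mu0 : 0 < mu by rewrite divr_gt0.
(* By the choice of [nu], this is [min (1 / w j) mu]; [v] below is the family of dual weights. *)
pose u (j : 'I_p) := if (j < nu)%N then mu else (w j)^-1.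
have u0 j : 0 < u j by rewrite /u; case: ifP => // _; rewrite invr_gt0.
pose v j := w j * u j.
have v1 j : v j <= 1.
  rewrite /v /u; case: ifPn => [jnu|_]; last by rewrite mulfV ?gt_eqF.
  by rewrite /mu mulrA ler_pdivrMr// mul1r mulrC wle.
(* The terms from [nu] on vanish; the others give [nu - mu * T nu = nu - (nu - 2)]. *)
have vsum : \sum_j (1 - v j) = 2.
  rewrite (bigID (fun j : 'I_p => (j < nu)%N))/= [X in _ + X]big1 ?addr0.
    under eq_bigr => j jnu do rewrite /v /u jnu.
    rewrite sumrB -mulr_suml -/(T nu) /mu mulrC divfK ?gt_eqF//.
    rewrite -(big_ord_widen _ (fun=> 1 : R)); last by case/andP: nu3p.
    by rewrite sumr_const card_ord opprB addrC subrK.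
  move=> j; rewrite -leqNgt => jnu.
  by rewrite /v /u ltnNge jnu /= mulfV ?subrr ?gt_eqF.
(* The left side is the squared ellipsoidal norm [\sum_j w j * u j ^+ 2]; its first block is
   [mu ^+ 2 * T nu]. *)
have uvsum : \sum_j v j * u j = M nu.
  rewrite (bigID (fun j : 'I_p => (j < nu)%N))/=; congr (_ + _).
    under eq_bigr => j jnu do rewrite /v /u jnu -mulrA.
    rewrite -mulr_suml -/(T nu) /mu.
    by field; rewrite gt_eqF.
  rewrite (eq_bigl (fun j : 'I_p => (nu <= j)%N)); last by move=> j; rewrite -leqNgt.
  apply: eq_bigr => j jnu; rewrite qE /v /u ltnNge jnu /= mulfV ?mul1r//.
  by rewrite gt_eqF.
(* Twice the maximum [m] is [\sum_j (1 - v j) * m], and each weight [1 - v j] is nonnegative, so [m]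
   may be lowered to [d j * b j] term by term. *)
have dual_le b : (forall j, 0 <= b j) -> cstar d b <= \sum_j v j * (d j * b j).
  move=> b0; rewrite /cstar; set m := \big[_/_]_(_ < _) _.
  rewrite lerBlDr -lerBlDl -sumrB -vsum mulr_suml; apply: ler_sum => j _.
  rewrite -[X in X - _]mul1r -mulrBl ler_wpM2l ?subr_ge0//.
  exact: (le_bigmax 0 (fun j => d j * b j)).
(* In the coordinates [d j * a j] this is [u], scaled by [K nu] onto the ellipsoid of feasible
   points, because [K nu ^+ 2 * M nu = S]. *)
pose a j := K nu * u j / d j.
have daE j : d j * a j = K nu * u j by rewrite /a mulrC divfK ?gt_eqF.
have umu j : u j <= mu.
  rewrite /u; case: ifPn => //; rewrite -leqNgt => jnu.
  by rewrite invf_ple ?posrE// /mu invf_div ler_pdivrMr// mulrC ltW// wgt.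
have mE : K nu * mu = \big[Num.max/0]_(j < p) (d j * a j).
  apply/le_anti/andP; split.
    pose i := Ordinal (leq_trans (ltn0Sn 2) p3).
    have -> : K nu * mu = d i * a i.
      by rewrite daE /u (_ : (i < nu)%N)//; case/andP: nu3p => /(leq_trans _) ->.
    exact: (le_bigmax 0 (fun j => d j * a j)).
  apply: bigmax_le => [|j _]; first by rewrite ltW// mulr_gt0.
  by rewrite daE ler_pM2l.
(* Equality holds in [dual_le] at [a]: for [j < nu] the value [d j * a j] is the maximum, and for
   the other [j] the weight [1 - v j] is zero. *)
have cE : cstar d a = K nu * M nu.
  rewrite /cstar -mE -vsum -uvsum mulr_sumr mulr_suml -sumrB.
  apply: eq_bigr => j _; rewrite daE /v /u; case: ifPn => _; first by ring.
  by rewrite mulfV ?gt_eqF//; ring.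
exists a, nu, (K nu * mu); split=> //; split=> //.
split=> [j jnu|]; first by rewrite daE /u jnu.
split=> [j jnu|].
  rewrite daE ltr_pM2l// /u ltnNge jnu /=.
  by rewrite invf_plt ?posrE// /mu invf_div ltr_pdivrMr// mulrC wgt.
split=> [j jnu|]; first by rewrite /a /u jnu /mu; ring.
split=> [j jnu|].
  rewrite /a /u ltnNge jnu /= /w; field.
  by rewrite !gt_eqF.
split; first by rewrite cE mulr_gt0.
have awE (b : 'I_p -> R) : \sum_j (d j + g j) * b j ^+ 2
    = \sum_j w j * (d j * b j) ^+ 2.
  apply: eq_bigr => j _; rewrite /w; field.
  by rewrite gt_eqF.
have fa : feasible d g a.
  split=> [j|]; first by rewrite ltW// divr_gt0// mulr_gt0.
  rewrite awE -/S -K2M -uvsum mulr_sumr; apply: eq_bigr => j _.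
  by rewrite daE /v; ring.
have K20 : 0 < 2 * K nu by exact: mulr_gt0.
split=> //; exists (2 * K nu) => //.
move=> b [b0]; rewrite awE -/S => bS.
rewrite (awE (fun j => b j - a j)).
(* Expanding the square: both points have squared norm [S], and the cross term is linear in [b] with
   weights [w j * K nu * u j = K nu * v j]. Since [S = K nu * cstar d a], the claim with constant
   [2 * K nu] becomes [dual_le]. *)
have -> : \sum_j w j * (d j * (b j - a j)) ^+ 2
    = 2 * S - 2 * K nu * \sum_j v j * (d j * b j).
  rewrite mulr_natl mulr2n -{1}bS -{1}K2M -uvsum !mulr_sumr -big_split -sumrB.
  apply: eq_bigr => j _; rewrite mulrBr daE /v /=; ring.
have -> : 2 * S = 2 * K nu * cstar d a by rewrite cE -K2M; ring.
by rewrite [leRHS]opprB -mulrBr (ler_pM2l K20) lerD2r dual_le.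
Qed.

End Optimum.

(** * Iterated integrals *)

Local Open Scope classical_set_scope.

Section Limits.
Variable R : realType.
Local Open Scope ereal_scope.

Lemma limn_einf_ge0 (u : nat -> \bar R) : (forall n, 0 <= u n) -> 0 <= limn_einf u.
Proof.
move=> u0; rewrite limn_einf_lim; apply: lime_ge; first exact: is_cvg_einfs.
by apply: nearW => n; apply: le_ereal_inf_tmp => _ [k _ <-].
Qed.

Lemma measurable_fun_limn_einf d (T : measurableType d) (f : nat -> T -> \bar R) :
  (forall n, measurable_fun [set: T] (f n)) ->
  measurable_fun [set: T] (fun x => limn_einf (f ^~ x)).
Proof.
move=> mf; rewrite (_ : (fun x => _) =
    (fun x => - limn_esup ((fun n y => - f n y) ^~ x))).
  apply: measurableT_comp => //; apply: measurable_fun_limn_esup => n.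
  exact: measurableT_comp.
by apply/funext => x; rewrite -limn_einfN; congr limn_einf; apply/funext => n /=; rewrite oppeK.
Qed.

End Limits.

Section IteratedIntegrals.
Variable R : realType.
Local Notation mu := (@lebesgue_measure R).
Implicit Types f : (nat -> R) -> \bar R.
Local Open Scope ereal_scope.

(** The substitution made at each layer of [iter_int]: the body of [iter_int n.+1 f] is
    [iter_int n (fun y => f (upd n t y))]. *)
Definition upd (n : nat) (t : R) (y : nat -> R) : nat -> R :=
  fun k => if k == n then t else y k.

(* Rather than putting a sigma-algebra on [nat -> R], functionals of a sequence
   are tested against arbitrary measurable families of coordinates. *)
Definition jointly_measurable d (T : measurableType d)
    (F : T -> (nat -> R) -> \bar R) : Prop :=
  forall d' (U : measurableType d') (t : U -> T) (h : nat -> U -> R),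
    measurable_fun [set: U] t -> (forall k, measurable_fun [set: U] (h k)) ->
    measurable_fun [set: U] (fun u => F (t u) (fun k => h k u)).

Definition coord_measurable f : Prop :=
  forall d (U : measurableType d) (h : nat -> U -> R),
    (forall k, measurable_fun [set: U] (h k)) ->
    measurable_fun [set: U] (fun u => f (fun k => h k u)).

Lemma jointly_measurable_upd d (T : measurableType d)
    (F : T -> (nat -> R) -> \bar R) n : jointly_measurable d T F ->
  jointly_measurable _ (T * measurableTypeR R)%type
    (fun ts y => F ts.1 (upd n ts.2 y)).
Proof.
move=> mF d' U t h mt mh.
apply: (mF _ U (fst \o t) (fun k u => upd n (t u).2 (fun k => h k u) k)).
  by apply: measurableT_comp.
move=> k; rewrite /upd; case: (k == n) => //.
by apply: (@measurableT_comp _ _ _ _ _ (measurableTypeR R) snd).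
Qed.

Lemma coord_measurable_upd f n t :
  coord_measurable f -> coord_measurable (fun y => f (upd n t y)).
Proof.
move=> mf d U h mh.
apply: (mf _ U (fun k u => upd n t (fun k => h k u) k)) => k.
by rewrite /upd; case: (k == n) => //; exact: measurable_cst.
Qed.

Lemma jointly_measurable_upd1 f n : coord_measurable f ->
  jointly_measurable _ (measurableTypeR R) (fun t y => f (upd n t y)).
Proof.
move=> mf d' U t h mt mh.
apply: (mf _ U (fun k u => upd n (t u) (fun k => h k u) k)) => k.
by rewrite /upd; case: (k == n).
Qed.

Lemma iter_int_ge0 n f : (forall y, 0 <= f y) -> 0 <= iter_int n f.
Proof.
elim: n f => [|n IH] f f0 /=; first exact: f0.
by apply: integral_ge0 => t _; exact: IH.
Qed.

(** The parameter space grows with the induction: the outermost variable joins the parameter in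
    [T * R], and Tonelli's theorem gives measurability after integrating it out. *)
Lemma measurable_iter_int n d (T : measurableType d)
    (F : T -> (nat -> R) -> \bar R) : jointly_measurable d T F ->
  (forall t y, 0 <= F t y) -> measurable_fun [set: T] (fun t => iter_int n (F t)).
Proof.
elim: n d T F => [|n IH] d T F mF F0 /=.
  by apply: (mF _ T id (fun _ _ => 0%R)) => // k; exact: measurable_cst.
apply: (measurable_fun_fubini_tonelli_F (m2 := mu)
  (fun ts => iter_int n (fun y => F ts.1 (upd n ts.2 y)))).
- apply: (IH _ (T * measurableTypeR R)%type
    (fun ts y => F ts.1 (upd n ts.2 y))) => //.
  exact: jointly_measurable_upd.
- by move=> ts; exact: iter_int_ge0.
Qed.

Lemma measurable_iter_int_upd n f : coord_measurable f -> (forall y, 0 <= f y) ->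
  measurable_fun [set: measurableTypeR R]
    (fun t => iter_int n (fun y => f (upd n t y))).
Proof.
by move=> mf f0; apply: measurable_iter_int => //; exact: jointly_measurable_upd1.
Qed.

Lemma le_iter_int n f1 f2 : coord_measurable f1 -> coord_measurable f2 ->
  (forall y, 0 <= f1 y) -> (forall y, f1 y <= f2 y) ->
  iter_int n f1 <= iter_int n f2.
Proof.
elim: n f1 f2 => [|n IH] f1 f2 mf1 mf2 f0 f12 /=; first exact: f12.
have f20 y : 0 <= f2 y by exact: le_trans (f0 y) (f12 y).
apply: ge0_le_integral => //.
- by move=> t _; exact: iter_int_ge0.
- exact: measurable_iter_int_upd.
- exact: measurable_iter_int_upd.
- by move=> t _; apply: IH => //; exact: coord_measurable_upd.
Qed.

Lemma iter_intD n f1 f2 : coord_measurable f1 -> coord_measurable f2 ->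
  (forall y, 0 <= f1 y) -> (forall y, 0 <= f2 y) ->
  iter_int n (fun y => f1 y + f2 y) = iter_int n f1 + iter_int n f2.
Proof.
elim: n f1 f2 => [//|n IH] f1 f2 mf1 mf2 f10 f20 /=.
rewrite -ge0_integralD//.
- by apply: eq_integral => t _; apply: IH => //; exact: coord_measurable_upd.
- by move=> t _; exact: iter_int_ge0.
- exact: measurable_iter_int_upd.
- by move=> t _; exact: iter_int_ge0.
- exact: measurable_iter_int_upd.
Qed.

Lemma iter_int_sum n (I : Type) (s : seq I) (F : I -> (nat -> R) -> \bar R) :
  (forall i, coord_measurable (F i)) -> (forall i y, 0 <= F i y) ->
  iter_int n (fun y => \sum_(i <- s) F i y) = \sum_(i <- s) iter_int n (F i).
Proof.
move=> mF F0; elim: s => [|i s IH].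
  rewrite big_nil; under eq_fun do rewrite big_nil.
  by elim: (n) => //= m ->; rewrite integral0.
rewrite big_cons -IH -iter_intD//.
- by under eq_fun do rewrite big_cons.
- by move=> d U h mh; apply: emeasurable_sum => j; exact: mF.
- by move=> y; exact: sume_ge0.
Qed.

(** Tonelli exchanges [s] with the outermost variable of [iter_int]; the induction carries it past
    the remaining ones. *)
Lemma iter_int_swap n (F : R -> (nat -> R) -> \bar R) :
  jointly_measurable _ (measurableTypeR R) F -> (forall s y, 0 <= F s y) ->
  \int[mu]_s iter_int n (F s) = iter_int n (fun y => \int[mu]_s F s y).
Proof.
elim: n F => [//|n IH] F mF F0 /=.
rewrite (fubini_tonelli (m1 := mu) (m2 := mu)
  (fun st => iter_int n (fun y => F st.1 (upd n st.2 y)))).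
- apply: eq_integral => t _; apply: (IH (fun s y => F s (upd n t y))) => //.
  move=> d U s h ms mh.
  apply: (mF _ U s (fun k u => upd n t (fun k => h k u) k)) => // k.
  by rewrite /upd; case: (k == n) => //; exact: measurable_cst.
- apply: measurable_iter_int => //; exact: jointly_measurable_upd.
- by move=> st; exact: iter_int_ge0.
Qed.

(** The induction handles the inner integrals for each fixed outer variable, and Fatou's lemma on
    the line handles the outermost one. *)
Lemma iter_int_fatou n (F : nat -> (nat -> R) -> \bar R) :
  (forall i, coord_measurable (F i)) -> (forall i y, 0 <= F i y) ->
  iter_int n (fun y => limn_einf (F ^~ y)) <= limn_einf (fun i => iter_int n (F i)).
Proof.
elim: n F => [//|n IH] F mF F0 /=.
have ml : coord_measurable (fun y => limn_einf (F ^~ y)).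
  by move=> d U h mh; apply: measurable_fun_limn_einf => i; exact: mF.
have l0 y : 0 <= limn_einf (F ^~ y) by exact: limn_einf_ge0.
apply: le_trans (fatou mu measurableT _ _); last 2 first.
- by move=> i; exact: (measurable_iter_int_upd n (F i)).
- by move=> i t _; exact: iter_int_ge0.
apply: ge0_le_integral => //.
- by move=> t _; exact: iter_int_ge0.
- exact: (measurable_iter_int_upd n (fun y => limn_einf (F ^~ y))).
- by apply: measurable_fun_limn_einf => i; exact: (measurable_iter_int_upd n (F i)).
- move=> t _; apply: (IH (fun i y => F i (upd n t y))) => // i.
  exact: coord_measurable_upd.
Qed.

End IteratedIntegrals.

(** * Integration against a product of probability densities *)

Section ProductDensity.
Variable R : realType.
Local Notation mu := (@lebesgue_measure R).
Variable phi : nat -> R -> R.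
Hypotheses (phi_ge0 : forall k t, 0 <= phi k t)
  (phi_meas : forall k, measurable_fun [set: measurableTypeR R] (phi k))
  (phi_int : forall k, (\int[mu]_t (phi k t)%:E = 1)%E).

Let prod_ge0 n (y : nat -> R) : 0 <= \prod_(k < n) phi k (y k).
Proof. exact: prodr_ge0. Qed.

Lemma coord_measurable_density n (H : (nat -> R) -> R) :
  coord_measurable _ (fun y => (H y)%:E) ->
  coord_measurable _ (fun y => (H y * \prod_(k < n) phi k (y k))%:E).
Proof.
move=> mH d U h mh; apply/measurable_EFinP; apply: measurable_funM.
  by apply/measurable_EFinP; exact: mH.
by apply: measurable_prod => k _; exact: (measurableT_comp (phi_meas k) (mh k)).
Qed.

Lemma density_upd n (y : nat -> R) t :
  \prod_(k < n.+1) phi k (upd _ n t y k) = phi n t * \prod_(k < n) phi k (y k).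
Proof.
rewrite big_ord_recr /= mulrC /upd eqxx; congr (_ * _).
by apply: eq_bigr => k _; rewrite (ltn_eqF (ltn_ord k)).
Qed.

(** The constant [c] is general because the induction absorbs the factor [phi n t] into it. *)
Lemma iter_int_density n (c : R) : 0 <= c ->
  iter_int n (fun y => (c * \prod_(k < n) phi k (y k))%:E) = c%:E.
Proof.
elim: n c => [|n IH] c c0 /=; first by rewrite big_ord0 mulr1.
rewrite (@eq_integral _ _ _ mu _ (fun t => c%:E * (phi n t)%:E)%E).
  rewrite ge0_integralZl_EFin ?phi_int ?mule1//.
  - by move=> t _; rewrite lee_fin.
  - by apply/measurable_EFinP; exact: phi_meas.
move=> t _; rewrite -EFinM -IH ?mulr_ge0//; congr iter_int.
by apply/funext => y; rewrite density_upd mulrA.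
Qed.

(** Reduces a bound on a multiple integral to a bound in the single variable [j], uniform in the
    others. If [j] is the outermost variable it is swapped inwards; otherwise the outer factor
    [phi n t] is absorbed into [H] and [c]. *)
Lemma iter_int_density_le n j (H : (nat -> R) -> R) (c : R) :
  (j < n)%N -> 0 <= c -> (forall y, 0 <= H y) ->
  coord_measurable _ (fun y => (H y)%:E) ->
  (forall y, (\int[mu]_t (H (upd _ j t y) * phi j t)%:E <= c%:E)%E) ->
  (iter_int n (fun y => (H y * \prod_(k < n) phi k (y k))%:E) <= c%:E)%E.
Proof.
elim: n H c => [//|n IH] H c; rewrite ltnS leq_eqVlt => /predU1P[->|jn] c0 H0 mH Hc /=.
  (* Case [j = n]: the integral over [t] is moved innermost, where the hypothesis bounds it by [c]
     times the remaining density. *)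
  pose F t y := (H (upd _ n t y) * phi n t * \prod_(k < n) phi k (y k))%:E.
  have mF : jointly_measurable _ _ (measurableTypeR R) F.
    move=> d U t h mt mh; apply/measurable_EFinP; apply: measurable_funM.
      apply: measurable_funM; last exact: (measurableT_comp (phi_meas n) mt).
      apply/measurable_EFinP; exact: (jointly_measurable_upd1 _ _ n mH).
    by apply: measurable_prod => k _; exact: (measurableT_comp (phi_meas k) (mh k)).
  have F0 t y : (0 <= F t y)%E by rewrite lee_fin !mulr_ge0.
  rewrite (@eq_integral _ _ _ mu _ (fun t => iter_int n (F t))); last first.
    move=> t _; congr iter_int.
    by apply/funext => y; rewrite density_upd mulrA.
  rewrite iter_int_swap// -[leRHS](iter_int_density n c c0).
  apply: le_iter_int.
  - move=> d U h mh.
    apply: (measurable_fun_fubini_tonelli_F (m2 := mu)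
      (fun ut => F ut.2 (fun k => h k ut.1))) => //.
    apply: (mF _ (U * measurableTypeR R)%type snd (fun k ut => h k ut.1)) => //.
    by move=> k; apply: measurableT_comp.
  - move=> d U h mh; apply/measurable_EFinP; apply: measurable_funM => //.
    by apply: measurable_prod => k _; exact: (measurableT_comp (phi_meas k) (mh k)).
  - by move=> y; exact: integral_ge0.
  - move=> y; rewrite (@eq_integral _ _ _ mu _ (fun t => (\prod_(k < n) phi k (y k))%:E *
      (H (upd _ n t y) * phi n t)%:E)%E); last first.
      by move=> t _; rewrite /F -EFinM mulrC.
    rewrite ge0_integralZl_EFin//.
    + by rewrite EFinM muleC lee_wpmul2r ?lee_fin.
    + by move=> t _; rewrite lee_fin mulr_ge0.
    + apply/measurable_EFinP; apply: measurable_funM; last exact: phi_meas.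
      apply/measurable_EFinP.
      apply: (jointly_measurable_upd1 _ _ n mH _ (measurableTypeR R) id (fun k _ => y k)) => //.
(* Case [j < n]: for fixed [t] the inner integral is at most [c * phi n t], by induction. *)
apply: (@le_trans _ _ (\int[mu]_t (c * phi n t)%:E)%E); last first.
  rewrite (@eq_integral _ _ _ mu _ (fun t => c%:E * (phi n t)%:E)%E)//.
  rewrite ge0_integralZl_EFin ?phi_int ?mule1//.
  - by move=> t _; rewrite lee_fin.
  - by apply/measurable_EFinP; exact: phi_meas.
apply: ge0_le_integral => //.
- by move=> t _; apply: iter_int_ge0 => y; rewrite lee_fin mulr_ge0 ?prodr_ge0.
- apply: (measurable_iter_int_upd _ n (fun y => (H y * \prod_(k < n.+1) phi k (y k))%:E)).
    exact: coord_measurable_density.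
  by move=> y; rewrite lee_fin mulr_ge0.
- by apply/measurable_EFinP; apply: measurable_funM => //; exact: phi_meas.
move=> t _.
rewrite (_ : (fun y => _) = (fun y => ((H (upd _ n t y) * phi n t)
    * \prod_(k < n) phi k (y k))%:E)); last first.
  by apply/funext => y; rewrite density_upd mulrA.
apply: (IH (fun y => H (upd _ n t y) * phi n t)) => //.
- by rewrite mulr_ge0.
- by move=> y; rewrite mulr_ge0.
- move=> d U h mh; apply/measurable_EFinP; apply: measurable_funM => //.
  apply/measurable_EFinP; exact: (coord_measurable_upd _ _ n t mH).
move=> y.
have updC s : upd _ n t (upd _ j s y) = upd _ j s (upd _ n t y).
  apply/funext => k; rewrite /upd.
  case: (eqVneq k n) => [->|//]; by rewrite gtn_eqF.
rewrite (@eq_integral _ _ _ mu _ (fun s => (phi n t)%:E *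
   (H (upd _ j s (upd _ n t y)) * phi j s)%:E)%E); last first.
  by move=> s _; rewrite updC -EFinM mulrAC mulrC.
rewrite ge0_integralZl_EFin//.
- by rewrite EFinM muleC lee_wpmul2r ?lee_fin.
- by move=> s _; rewrite lee_fin mulr_ge0.
- apply/measurable_EFinP; apply: measurable_funM; last exact: phi_meas.
  apply/measurable_EFinP.
  apply: (jointly_measurable_upd1 _ _ j mH _ (measurableTypeR R) id
    (fun k _ => upd _ n t y k)) => //.
Qed.

End ProductDensity.

(** * Stein's identity in one variable *)

Section Gaussian.
Variable R : realType.
Local Notation mu := (@lebesgue_measure R).
Implicit Types m v t : R.

Lemma gauss_pdfE m v : 0 < v -> gauss_pdf m v = normal_pdf m (Num.sqrt v).
Proof.
move=> v0; rewrite normal_pdfE ?gt_eqF ?sqrtr_gt0//; apply/funext => t.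
rewrite /gauss_pdf /normal_peak /normal_fun sqr_sqrtr ?ltW// mulrC.
by congr ((Num.sqrt _)^-1 * expR (_ / _)); ring.
Qed.

Lemma gauss_pdf_gt0 m v t : 0 < v -> 0 < gauss_pdf m v t.
Proof. by move=> v0; rewrite divr_gt0 ?expR_gt0// sqrtr_gt0 !mulr_gt0 ?pi_gt0. Qed.

Lemma measurable_gauss_pdf m v : 0 < v ->
  measurable_fun [set: measurableTypeR R] (gauss_pdf m v).
Proof. by move=> v0; rewrite gauss_pdfE//; exact: measurable_normal_pdf. Qed.

Lemma integral_gauss_pdf m v : 0 < v -> (\int[mu]_t (gauss_pdf m v t)%:E = 1)%E.
Proof. by move=> v0; rewrite gauss_pdfE// integral_normal_pdf. Qed.

Lemma is_derive_gauss_pdf m v t : 0 < v ->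
  is_derive t 1 (gauss_pdf m v) (- (t - m) / v * gauss_pdf m v t).
Proof.
move=> v0; rewrite /gauss_pdf.
have sub : is_derive t (1 : R) (fun x => x - m) (1 - 0) by exact: is_deriveB.
have sq : is_derive t (1 : R) (fun x => (- (2 * v)^-1) * (x - m) ^+ 2)
    (- (2 * v)^-1 * (2 * (t - m))).
  apply: is_derive_eq.
  by rewrite /GRing.scale /= subr0; ring.
have ex : is_derive t (1 : R) (fun x => expR ((- (2 * v)^-1) * (x - m) ^+ 2))
    (expR (- (2 * v)^-1 * (t - m) ^+ 2) * (- (2 * v)^-1 * (2 * (t - m)))).
  exact: is_derive1_comp.
have := is_deriveM ex (is_derive_cst (Num.sqrt (2 * pi * v))^-1 t (1 : R)).
rewrite (_ : _ * _ = (fun x => expR (- (x - m) ^+ 2 / (2 * v)) / Num.sqrt (2 * pi * v))).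
  move=> H; apply: is_derive_eq; rewrite scaler0 add0r /GRing.scale /=.
  rewrite (_ : - (2 * v)^-1 * (t - m) ^+ 2 = - (t - m) ^+ 2 / (2 * v)); last by ring.
  by field; rewrite !gt_eqF// sqrtr_gt0 !mulr_gt0 ?pi_gt0.
by apply/funext => x /=; congr (expR _ / _); ring.
Qed.

(** From [1 + x <= expR x] at [x = (t - m) ^+ 2 / (2 * v)]. Decay of order [1 / n] is enough, since
    it only has to kill boundary terms with a bounded factor. *)
Lemma gauss_pdf_tail m v : 0 < v -> exists2 c : R, 0 <= c &
  forall (n : nat) t, `|t - m| = n.+1%:R -> gauss_pdf m v t <= c / n.+1%:R.
Proof.
move=> v0; pose s := (Num.sqrt (2 * pi * v))^-1.
have s0 : 0 < s by rewrite invr_gt0 sqrtr_gt0 !mulr_gt0 ?pi_gt0.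
exists (2 * v * s); first by rewrite ltW// !mulr_gt0.
move=> n t tn; rewrite /gauss_pdf -/s mulrAC ler_pM2r//.
have n0 : 0 < n.+1%:R :> R by [].
rewrite -real_normK ?num_real// tn mulNr expRN -[leRHS]invf_div lef_pV2 ?posrE ?divr_gt0 ?mulr_gt0 ?expR_gt0//.
apply: le_trans (expR_ge1Dx _); rewrite -[leLHS]add0r lerD//.
by rewrite ler_pM2r ?invr_gt0 ?mulr_gt0// expr2 ler_peMr// ler1n.
Qed.

End Gaussian.

Section Stein.
Variable R : realType.
Local Notation mu := (@lebesgue_measure R).
Variables (m v C B : R) (h h' : R -> R).
Hypotheses (v0 : 0 < v) (C0 : 0 <= C)
  (dh : forall t : R, is_derive t (1 : R) h (h' t)) (ch' : continuous h')
  (hB : forall t, `|h t| <= B).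
Let f t := (t - m) ^+ 2 + C + 2 * (v * h' t - (t - m) * h t).
Hypothesis f0 : forall t, 0 <= f t.

Let phi := gauss_pdf m v.

Let phi_ge0 t : 0 <= phi t. Proof. by rewrite ltW// gauss_pdf_gt0. Qed.

Let dphi (t : R) : is_derive t (1 : R) phi (- (t - m) / v * phi t).
Proof. exact: is_derive_gauss_pdf. Qed.

Let cphi : continuous phi.
Proof. by move=> t; apply/differentiable_continuous/derivable1_diffP; case: (dphi t). Qed.

Let ch : continuous h.
Proof. by move=> t; apply/differentiable_continuous/derivable1_diffP; case: (dh t). Qed.

(* [f * phi] is [(C + v) * phi] plus the derivative of [G]; over
   [[m - n, m + n]] the linear part of [G] contributes a negative boundary
   term, which is dropped. *)
Let G t := v * (2 * h t - (t - m)) * phi t.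
Let G' t := (f t - (C + v)) * phi t.

Let dG (t : R) : is_derive t (1 : R) G (G' t).
Proof.
have sub : is_derive t (1 : R) (fun x => x - m) (1 - 0) by exact: is_deriveB.
have h2 : is_derive t (1 : R) (fun x => 2 * h x - (x - m)) (2 * h' t - (1 - 0)).
  by apply: is_deriveB; exact: is_deriveZ.
have vh : is_derive t (1 : R) (fun x => v * (2 * h x - (x - m))) (v * (2 * h' t - (1 - 0))).
  exact: is_deriveZ.
apply: (is_derive_eq (is_deriveM vh (dphi t))).
by rewrite /GRing.scale /= /G' /f; field; rewrite gt_eqF.
Qed.

Let cG' : continuous G'.
Proof.
move=> t; apply: cvgM; last exact: cphi.
apply: cvgB; last exact: cvg_cst.
apply: cvgD.
  apply: cvgD; last exact: cvg_cst.
  by apply: (@cvgM _ _ _ _ (fun x => x - m) (fun x => x - m)); apply: cvgB => //; exact: cvg_cst.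
apply: cvgM; first exact: cvg_cst.
apply: cvgB; apply: cvgM; [exact: cvg_cst|exact: ch'| |exact: ch].
by apply: cvgB => //; exact: cvg_cst.
Qed.

Let int_G' a b : a < b -> (\int[mu]_(t in `[a, b]) (G' t)%:E = (G b - G a)%:E)%E.
Proof.
move=> ab; rewrite (@continuous_FTC2 _ G' G a b)//.
- exact: continuous_subspaceT.
- have cG : continuous G.
    by move=> t; apply/differentiable_continuous/derivable1_diffP; case: (dG t).
  split.
  + by move=> t _; case: (dG t).
  + exact: cvg_at_right_filter (cG a).
  + exact: cvg_at_left_filter (cG b).
- by move=> t _; rewrite derive1E; case: (dG t).
Qed.

(** Nonnegativity of the integrand replaces integrability of [h']: the fundamental theorem of
    calculus bounds the integrals over growing intervals around [m], and monotone convergence passes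
    to the line. *)
Lemma stein_inequality :
  (\int[mu]_t (((t - m) ^+ 2 + C + 2 * (v * h' t - (t - m) * h t))
     * gauss_pdf m v t)%:E <= (v + C)%:E)%E.
Proof.
have C'v0 : 0 <= C + v by rewrite addr_ge0// ltW.
have [c c0 phic] := gauss_pdf_tail R m v v0.
have cphi' (n : nat) : phi (m - n.+1%:R) <= c / n.+1%:R /\ phi (m + n.+1%:R) <= c / n.+1%:R.
  by split; apply: phic; rewrite addrAC subrr add0r ?normrN normr_nat.
have B0 : 0 <= B by exact: le_trans (normr_ge0 (h 0)) (hB 0).
pose I (n : nat) := `[m - n.+1%:R, m + n.+1%:R].
have mI n : measurable (I n : set (measurableTypeR R)) by exact: measurable_itv.
have phi_int (n : nat) : (\int[mu]_(t in I n) (phi t)%:E <= 1)%E.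
  rewrite -(integral_gauss_pdf R m v v0); apply: ge0_subset_integral => //.
    by apply/measurable_EFinP; exact: measurable_gauss_pdf.
  by move=> t _; rewrite lee_fin.
(* Each endpoint contributes at most [2 * v * B * c / n.+1]: the linear part of [G] has the
   favourable sign there, [h] is bounded by [B], and [phi] by [c / n.+1]. *)
have bound (n : nat) : (\int[mu]_(t in I n) (f t * phi t)%:E
    <= (v + C)%:E + (4 * v * B * c)%:E * (n.+1%:R^-1)%:E)%E.
  have ab : m - n.+1%:R < m + n.+1%:R.
    by rewrite ltrD2l (lt_trans (y := 0)) ?oppr_lt0.
  rewrite (@eq_integral _ _ _ mu _ (fun t => ((C + v) * phi t)%:E + (G' t)%:E)%E); last first.
    by move=> t _; rewrite -EFinD /G'; congr EFin; ring.
  rewrite integralD//; last 2 first.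
  - apply: continuous_compact_integrable; first exact: segment_compact.
    apply: continuous_subspaceT => t; apply: cvgM; [exact: cvg_cst|exact: cphi].
  - apply: continuous_compact_integrable; first exact: segment_compact.
    exact: continuous_subspaceT.
  rewrite int_G'// (@eq_integral _ _ _ mu _ (fun t => (C + v)%:E * (phi t)%:E)%E)//.
  rewrite ge0_integralZl_EFin//; last 2 first.
  - by move=> t _; rewrite lee_fin.
  - by apply/measurable_EFinP; apply: measurable_funTS; exact: measurable_gauss_pdf.
  apply: leeD; first by rewrite (addrC v) -[leRHS]mule1 lee_wpmul2l ?lee_fin.
  rewrite -EFinM lee_fin /G.
  have [p1 p2] := cphi' n.
  have n0 : 0 < n.+1%:R :> R by [].
  have := hB (m - n.+1%:R); have := hB (m + n.+1%:R).
  rewrite !ler_norml => /andP[_ h2] /andP[h1 _].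
  have q1 : v * (2 * h (m + n.+1%:R) - (m + n.+1%:R - m)) * phi (m + n.+1%:R)
      <= v * (2 * B) * (c / n.+1%:R).
    apply: (@le_trans _ _ (v * (2 * B) * phi (m + n.+1%:R))).
      rewrite ler_wpM2r// ler_pM2l//; lra.
    by rewrite ler_wpM2l// !mulr_ge0// ltW.
  have q2 : - (v * (2 * h (m - n.+1%:R) - (m - n.+1%:R - m)) * phi (m - n.+1%:R))
      <= v * (2 * B) * (c / n.+1%:R).
    apply: (@le_trans _ _ (v * (2 * B) * phi (m - n.+1%:R))).
      rewrite -mulNr -mulrN ler_wpM2r// ler_pM2l//; lra.
    by rewrite ler_wpM2l// !mulr_ge0// ltW.
  have -> : 4 * v * B * c / n.+1%:R
    = v * (2 * B) * (c / n.+1%:R) + v * (2 * B) * (c / n.+1%:R) by ring.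
  exact: lerD.
pose F (n : nat) := (fun t => (f t * phi t)%:E) \_ (I n).
have f0' t : (0 <= (f t * phi t)%:E)%E by rewrite lee_fin mulr_ge0.
have mf : measurable_fun [set: measurableTypeR R] (fun t => f t * phi t).
  rewrite (_ : (fun t => _) = (fun t => (C + v) * phi t + G' t)); last first.
    by apply/funext => t; rewrite /G'; ring.
  apply: measurable_funD.
    by apply: measurable_funM => //; exact: measurable_gauss_pdf.
  exact: continuous_measurable_fun.
have F0 n t : (0 <= F n t)%E by rewrite /F patchE; case: ifP.
have mF n : measurable_fun [set: measurableTypeR R] (F n).
  apply/(measurable_restrictT _ _).1 => //.
  by apply: measurable_funTS; apply/measurable_EFinP.
have hF t : {homo F ^~ t : a b / (a <= b)%N >-> (a <= b)%E}.
  move=> a b ab; rewrite /F !patchE; case: ifPn => ta; last by case: ifP.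
  rewrite ifT//; move: ta; rewrite !inE /I /= !in_itv /= => /andP[t1 t2].
  have ab' : a.+1%:R <= b.+1%:R :> R by rewrite ler_nat.
  by apply/andP; split; lra.
(* The sequence is constant once [n] exceeds [|t - m|]. *)
have limF t : limn (F ^~ t) = (f t * phi t)%:E.
  apply/cvg_lim => //; apply: cvg_near_cst.
  near=> n; rewrite /F patchE ifT// inE /I /= in_itv /=.
  have : `|t - m| <= n.+1%:R.
    by rewrite -natr1 ler_wpDr//; near: n; exact: nbhs_infty_ger.
  by rewrite ler_norml => /andP[]; lra.
have := cvg_monotone_convergence (mu := mu) measurableT mF (fun n t _ => F0 n t) (fun t _ => hF t).
under eq_fun do rewrite -integral_mkcond.
under eq_integral do rewrite limF.
move=> cvgF.
have cvgr : (fun n : nat => v + C + (4 * v * B * c) * harmonic n) @ \oo --> v + C.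
  rewrite -[X in _ --> X]addr0 -[X in _ --> _ + X](mulr0 (4 * v * B * c)).
  apply: cvgD; first exact: cvg_cst.
  by apply: cvgM; [exact: cvg_cst|exact: cvg_harmonic].
have cvgb : ((v + C)%:E + (4 * v * B * c)%:E * (n.+1%:R^-1)%:E)%E @[n --> \oo] --> (v + C)%:E.
  under eq_fun do rewrite -EFinM -EFinD.
  apply: cvg_EFin; first by apply: nearW.
  exact: cvgr.
rewrite -(cvg_lim _ cvgF)// -(cvg_lim _ cvgb)//.
apply: lee_lim; [by apply/cvg_ex; eexists; exact: cvgF|by apply/cvg_ex; eexists; exact: cvgb|].
by apply: nearW => n; exact: bound.
Unshelve. all: by end_near.
Qed.


End Stein.

(** * Minimaxity *)

Section CoordinateStein.
Variable R : realType.
Local Notation mu := (@lebesgue_measure R).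

Lemma stein_coordinate (m v c a e s : R) : 0 < v -> 0 <= c -> 0 <= a -> 0 < e -> e <= s ->
  let C := (c ^+ 2 + 4 * c * a * v) / e in
  let f t := (t - m) ^+ 2 + C + 2 * (v * (c * a / ((a * t) ^+ 2 + s)
      - 2 * c * a * (a * t) ^+ 2 / ((a * t) ^+ 2 + s) ^+ 2)
      - (t - m) * (c / ((a * t) ^+ 2 + s) * (a * t))) in
  (forall t, 0 <= f t) /\
  (\int[mu]_t (f t * gauss_pdf m v t)%:E <= (v + C)%:E)%E.
Proof.
move=> v0 c0 a0 e0 es C f.
have s0 : 0 < s by exact: lt_le_trans es.
pose q t := (a * t) ^+ 2 + s.
have qe t : e <= q t by rewrite /q (le_trans es)// lerDr sqr_ge0.
have q0 t : 0 < q t by rewrite (lt_le_trans e0).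
pose h t := c / q t * (a * t).
pose h' t := c * a / q t - 2 * c * a * (a * t) ^+ 2 / q t ^+ 2.
have qV t : (q t)^-1 <= e^-1 by rewrite lef_pV2 ?posrE.
have qV0 t : 0 < (q t)^-1 by rewrite invr_gt0.
have atq t : (a * t) ^+ 2 / q t <= 1 by rewrite ler_pdivrMr// mul1r /q lerDl ltW.
have h2 t : h t ^+ 2 <= c ^+ 2 / e.
  rewrite (_ : h t ^+ 2 = c ^+ 2 * (((a * t) ^+ 2 / q t) * (q t)^-1)).
    rewrite ler_wpM2l ?sqr_ge0// (le_trans _ (qV t))//.
    by rewrite ler_piMl// ltW.
  by rewrite /h !exprMn expr2; ring.
have h'lb t : - (2 * c * a / e) <= h' t.
  have ca : 0 <= c * a by exact: mulr_ge0.
  have : 2 * c * a * (a * t) ^+ 2 / q t ^+ 2 <= 2 * c * a / e.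
    rewrite (_ : _ / _ = 2 * c * a * (((a * t) ^+ 2 / q t) * (q t)^-1)).
      rewrite ler_wpM2l ?mulr_ge0// (le_trans _ (qV t))//.
      by rewrite ler_piMl// ltW.
    by rewrite expr2 invfM; ring.
  have : 0 <= c * a / q t by rewrite divr_ge0// ltW.
  rewrite /h'; lra.
have f0 t : 0 <= f t.
  (* Completing the square splits [C] into the two bounds on [h] and [h'], leaving three nonnegative
     terms. *)
  have -> : f t = (t - m - h t) ^+ 2 + ((c ^+ 2 / e - h t ^+ 2)
      + 2 * v * (h' t + 2 * c * a / e)).
    by rewrite /f -/(q t) /C /h /h'; ring.
  rewrite addr_ge0 ?sqr_ge0// addr_ge0 ?subr_ge0//.
  apply: mulr_ge0; first by rewrite mulr_ge0// ltW.
  by rewrite -lerBlDr sub0r.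
split=> //.
have C0 : 0 <= C by rewrite divr_ge0 ?addr_ge0 ?sqr_ge0 ?mulr_ge0// ltW.
have dq (t : R) : is_derive t (1 : R) q (2 * a * (a * t)).
  rewrite /q; have da : is_derive t (1 : R) (fun x => a * x) (a * 1) by exact: is_deriveZ.
  apply: is_derive_eq; rewrite /GRing.scale /=; ring.
have dh (t : R) : is_derive t (1 : R) h (h' t).
  have da : is_derive t (1 : R) (fun x => a * x) (a * 1) by exact: is_deriveZ.
  have dV : is_derive t (1 : R) (fun x => (q x)^-1) (- (q t) ^- 2 *: (2 * a * (a * t))).
    by apply: is_deriveV; rewrite gt_eqF.
  have dc : is_derive t (1 : R) (fun x => c / q x) (c * (- (q t) ^- 2 *: (2 * a * (a * t)))).
    exact: is_deriveZ.
  apply: (is_derive_eq (is_deriveM dc da)).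
  rewrite /GRing.scale /= /h'; field; by rewrite gt_eqF.
have cq : continuous q.
  by move=> t; apply/differentiable_continuous/derivable1_diffP; case: (dq t).
have cV : continuous (fun t => (q t)^-1).
  by move=> t; apply: cvgV; [rewrite gt_eqF|exact: cq].
have cat : continuous (fun t : R => (a * t) ^+ 2).
  move=> t; apply: (@cvgM _ _ _ _ (fun t => a * t) (fun t => a * t));
    by apply: cvgM => //; exact: cvg_cst.
(* The bound on [h] comes from [|h| <= 1 + h ^+ 2]. *)
apply: (stein_inequality R m v C (1 + c ^+ 2 / e) h h') => //.
- move=> t; rewrite /h'.
  apply: cvgB; first by apply: cvgM; [exact: cvg_cst|exact: cV].
  apply: cvgM; first by apply: cvgM; [exact: cvg_cst|exact: cat].
  apply: cvgV; first by rewrite expf_eq0 /= gt_eqF.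
  by apply: cvgM; exact: cq.
- move=> t; apply: le_trans (_ : 1 + h t ^+ 2 <= _); last by rewrite lerD2l.
  by rewrite -[h t ^+ 2]real_normK ?num_real//; nra.
Qed.

End CoordinateStein.

(** * Risk of the smoothed estimator and passage to the limit *)

Section Minimaxity.
Variables (R : realType) (p : nat) (d a theta : 'I_p -> R).
Hypotheses (d0 : forall j, 0 < d j) (a0 : forall j, 0 <= a j)
  (c0 : 0 <= cstar d a).
Local Notation mu := (@lebesgue_measure R).
Let c := cstar d a.
Let Q (x : 'I_p -> R) := \sum_(k < p) (a k * x k) ^+ 2.

Let Q_ge0 x : 0 <= Q x. Proof. by apply: sumr_ge0 => j _; exact: sqr_ge0. Qed.

Definition shrink_reg (e : R) (x : 'I_p -> R) (j : 'I_p) : R :=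
  x j - c / (Q x + e) * (a j * x j).

(** The partial derivative in [x j] of the shrinkage term [c / (Q x + e) * (a j * x j)]. *)
Let div_g (e : R) (x : 'I_p -> R) (j : 'I_p) := c * a j / (Q x + e)
  - 2 * c * a j * (a j * x j) ^+ 2 / (Q x + e) ^+ 2.

(** Both sides are compared with [c ^+ 2 / s], where [s = Q x + e]. The left one is
    [c ^+ 2 * Q x / s ^+ 2]; on the right, bounding each [d j * a j] in the negative part by the
    maximum [m], and [Q x / s] by [1], leaves [c / s] times the definition of [cstar]. *)
Lemma divergence_bound (e : R) (x : 'I_p -> R) : 0 < e ->
  \sum_j (c / (Q x + e) * (a j * x j)) ^+ 2 <= \sum_j d j * div_g e x j.
Proof.
move=> e0; set s := Q x + e.
have s0 : 0 < s by rewrite ltr_wpDl.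
have Qs : Q x <= s by rewrite lerDl ltW.
pose m := \big[Num.max/0]_(j < p) (d j * a j).
have mj j : d j * a j <= m by exact: (le_bigmax 0 (fun j => d j * a j)).
have m0 : 0 <= m by exact: bigmax_ge_id.
have cE : c = \sum_j d j * a j - 2 * m by [].
apply: (@le_trans _ _ (c ^+ 2 / s)).
  under eq_bigr do rewrite exprMn.
  rewrite -mulr_sumr -/(Q x) expr_div_n -mulrA ler_wpM2l ?sqr_ge0//.
  by rewrite mulrC ler_pdivrMr ?exprn_gt0// expr2 mulrA mulVf ?gt_eqF// mul1r.
apply: (@le_trans _ _ (c / s * (\sum_j d j * a j - 2 * m * (Q x / s)))).
  rewrite expr2 mulrAC ler_wpM2l ?divr_ge0 ?(ltW s0)// {1}cE lerB// ler_piMr ?mulr_ge0//.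
  by rewrite ler_pdivrMr// mul1r.
rewrite mulrBr /Q mulr_suml !mulr_sumr -sumrB; apply: ler_sum => j _.
rewrite /div_g -/s.
have -> : c / s * (d j * a j) - c / s * (2 * m * ((a j * x j) ^+ 2 / s))
  = d j * (c * a j / s) - 2 * (c / s) * ((a j * x j) ^+ 2 / s) * m by ring.
have -> : d j * (c * a j / s - 2 * c * a j * (a j * x j) ^+ 2 / s ^+ 2)
  = d j * (c * a j / s) - 2 * (c / s) * ((a j * x j) ^+ 2 / s) * (d j * a j).
  by field; rewrite gt_eqF.
have sV : 0 <= s^-1 by rewrite invr_ge0 ltW.
rewrite lerB// ler_wpM2l//; apply: mulr_ge0; last by rewrite mulr_ge0// sqr_ge0.
by apply: mulr_ge0; first exact: ler0n; exact: mulr_ge0.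
Qed.

Lemma loss_bound (e : R) (x : 'I_p -> R) : 0 < e ->
  \sum_j (shrink_reg e x j - theta j) ^+ 2 <=
  \sum_j ((x j - theta j) ^+ 2 + 2 * (d j * div_g e x j
     - (x j - theta j) * (c / (Q x + e) * (a j * x j)))).
Proof.
move=> e0; have := divergence_bound e x e0 => H.
have -> : \sum_j (shrink_reg e x j - theta j) ^+ 2 =
   \sum_j ((x j - theta j) ^+ 2 - 2 * ((x j - theta j) * (c / (Q x + e) * (a j * x j))))
   + \sum_j (c / (Q x + e) * (a j * x j)) ^+ 2.
  by rewrite -big_split; apply: eq_bigr => j _; rewrite /shrink_reg /=; ring.
have -> : \sum_j ((x j - theta j) ^+ 2 + 2 * (d j * div_g e x j
     - (x j - theta j) * (c / (Q x + e) * (a j * x j)))) =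
   \sum_j ((x j - theta j) ^+ 2 - 2 * ((x j - theta j) * (c / (Q x + e) * (a j * x j))))
   + 2 * \sum_j d j * div_g e x j.
  by rewrite mulr_sumr -big_split; apply: eq_bigr => j _ /=; ring.
(* The weighted divergence dominates a sum of squares, so it is nonnegative and may be doubled,
   which matches the factor of the cross term for Stein's identity. *)
rewrite lerD2l (le_trans H)// ler_peMl ?ler1n//.
by rewrite (le_trans _ H)// sumr_ge0// => j _; exact: sqr_ge0.
Qed.


(** Indices from [p] on receive the standard normal density, so that every [phi k] is a probability
    density. *)
Let phi (k : nat) : R -> R :=
  if insub k is Some j then gauss_pdf (theta j) (d j) else gauss_pdf 0 1.

Let phiE (j : 'I_p) : phi j = gauss_pdf (theta j) (d j).
Proof. by rewrite /phi valK. Qed.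

Let phi_ge0 k t : 0 <= phi k t.
Proof. by rewrite /phi; case: insubP => [j _ _|_]; rewrite ltW// gauss_pdf_gt0. Qed.

Let phi_meas k : measurable_fun [set: measurableTypeR R] (phi k).
Proof. by rewrite /phi; case: insubP => [j _ _|_]; exact: measurable_gauss_pdf. Qed.

Let phi_int k : (\int[mu]_t (phi k t)%:E = 1)%E.
Proof. by rewrite /phi; case: insubP => [j _ _|_]; exact: integral_gauss_pdf. Qed.

(* Makes the integrand [H] nonnegative, so that Tonelli applies coordinatewise. *)
Let Cst (e : R) (j : 'I_p) := (c ^+ 2 + 4 * c * a j * d j) / e.

Let Cst_ge0 e j : 0 < e -> 0 <= Cst e j.
Proof. by move=> e0; rewrite divr_ge0 ?addr_ge0 ?sqr_ge0 ?mulr_ge0 ?(ltW (d0 j)) ?(ltW e0). Qed.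

Let H (e : R) (j : 'I_p) (y : nat -> R) : R :=
  let x := @restr R p y in
  (x j - theta j) ^+ 2 + Cst e j + 2 * (d j * div_g e x j
     - (x j - theta j) * (c / (Q x + e) * (a j * x j))).

(** In its own variable [j], with the others frozen into [s], [H e j] is the integrand of
    [stein_coordinate]. *)
Let H_coord e j : 0 < e -> (forall y, 0 <= H e j y) /\
  forall y, (\int[mu]_t (H e j (upd _ j t y) * phi j t)%:E <= (d j + Cst e j)%:E)%E.
Proof.
move=> e0; pose s y := \sum_(k < p | k != j) (a k * y (val k)) ^+ 2 + e.
have es y : e <= s y by rewrite lerDr; apply: sumr_ge0 => k _; exact: sqr_ge0.
have updE y t : H e j (upd _ j t y) = (t - theta j) ^+ 2 + Cst e j
    + 2 * (d j * (c * a j / ((a j * t) ^+ 2 + s y)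
      - 2 * c * a j * (a j * t) ^+ 2 / ((a j * t) ^+ 2 + s y) ^+ 2)
      - (t - theta j) * (c / ((a j * t) ^+ 2 + s y) * (a j * t))).
  have xj : restr (upd R j t y) j = t by rewrite /restr /upd eqxx.
  have Qs : Q (@restr R p (upd R j t y)) + e = (a j * t) ^+ 2 + s y.
    rewrite /Q (bigD1 j)//= xj /s addrA; congr (_ + _ + _).
    by apply: eq_bigr => k kj; rewrite /restr /upd val_eqE (negbTE kj).
  by rewrite /H /div_g Qs xj.
split=> [y|y]; have [f0 fi] := stein_coordinate R (theta j) (d j) c (a j) e (s y)
    (d0 j) c0 (a0 j) e0 (es y).
  have yE : upd _ j (y j) y = y.
    by apply/funext => k; rewrite /upd; case: eqP => // ->.
  by rewrite -yE updE.
apply: le_trans fi; under eq_integral do rewrite updE phiE.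
exact: lexx.
Qed.

Let measurable_coord d' (U : measurableType d') (h : nat -> U -> R) (j : 'I_p) :
  (forall k, measurable_fun [set: U] (h k)) ->
  measurable_fun [set: U] (fun u => @restr R p (fun k => h k u) j).
Proof. exact. Qed.

Let measurable_shrinkage (e : R) d' (U : measurableType d') (h : nat -> U -> R) : 0 < e ->
  (forall k, measurable_fun [set: U] (h k)) ->
  measurable_fun [set: U] (fun u => (Q (@restr R p (fun k => h k u)) + e)^-1).
Proof.
move=> e0 mh.
(* The inverse of the positive quantity [Q + e] is a composition of the measurable maps [expR],
   negation and [ln]. *)
rewrite (_ : (fun u => _) = (fun u => expR (- ln (Q (@restr R p (fun k => h k u)) + e)))).
  apply: measurableT_comp => //; apply: measurableT_comp => //.
  apply: measurableT_comp; first exact: measurable_ln.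
  apply: measurable_funD => //; apply: measurable_sum => k.
  apply: measurable_funX; apply: measurable_funM => //; exact: measurable_coord.
by apply/funext => u; rewrite expRN lnK// posrE ltr_wpDl.
Qed.

Let measurable_H e j : 0 < e -> coord_measurable _ (fun y => (H e j y)%:E).
Proof.
move=> e0 d' U h mh; apply/measurable_EFinP.
have mq := measurable_shrinkage e _ U h e0 mh.
have mj := measurable_coord _ U h j mh.
have ma : measurable_fun [set: U] (fun u => a j * @restr R p (fun k => h k u) j).
  exact: measurable_funM.
have mt : measurable_fun [set: U] (fun u => @restr R p (fun k => h k u) j - theta j).
  exact: measurable_funB.
apply: measurable_funD.
  by apply: measurable_funD => //; exact: measurable_funX.
apply: measurable_funM => //; apply: measurable_funB.
  apply: measurable_funM => //; apply: measurable_funB; first exact: measurable_funM.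
  rewrite /=; under eq_fun do rewrite -exprVn.
  apply: measurable_funM; last exact: measurable_funX.
  by apply: measurable_funM => //; exact: measurable_funX.
by apply: measurable_funM => //; apply: measurable_funM => //; exact: measurable_funM.
Qed.

Let loss (e : R) (y : nat -> R) := \sum_j (shrink_reg e (@restr R p y) j - theta j) ^+ 2.

Let loss_ge0 e y : 0 <= loss e y.
Proof. by apply: sumr_ge0 => j _; exact: sqr_ge0. Qed.

Let measurable_loss e : 0 < e -> coord_measurable _ (fun y => (loss e y)%:E).
Proof.
move=> e0 d' U h mh; apply/measurable_EFinP.
have mq := measurable_shrinkage e _ U h e0 mh.
apply: measurable_sum => j; apply: measurable_funX; apply: measurable_funB => //.
have mj := measurable_coord _ U h j mh.
apply: measurable_funB => //.
by apply: measurable_funM; apply: measurable_funM.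
Qed.

Let density (y : nat -> R) := \prod_(k < p) phi k (y k).

Let density_ge0 y : 0 <= density y. Proof. exact: prodr_ge0. Qed.

Lemma risk_shrink_reg e : 0 < e ->
  (iter_int p (fun y => (loss e y * density y)%:E) <= (\sum_j d j)%:E)%E.
Proof.
move=> e0; pose C := \sum_j Cst e j.
have C0 : 0 <= C by apply: sumr_ge0 => j _; exact: Cst_ge0.
have mloss := coord_measurable_density R phi phi_meas p _ (measurable_loss e e0).
have mC : coord_measurable _ (fun y => (C * density y)%:E).
  apply: (coord_measurable_density R phi phi_meas p (fun=> C)).
  by move=> d' U h mh; exact: measurable_cst.
have mH j := coord_measurable_density R phi phi_meas p _ (measurable_H e j e0).
(* Adding the finite constant [C], the integral of [C] times the density, lets [loss + C] be
   dominated by the sum of the nonnegative [H e j]; their integrals add up to [\sum_j d j + C]. *)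
rewrite -(@leeD2rE _ C%:E)// -[X in (_ + X <= _)%E](iter_int_density R phi phi_ge0 phi_meas phi_int p C C0).
have C_ge0 y : (0 <= (C * density y)%:E)%E by rewrite lee_fin mulr_ge0.
have l_ge0 y : (0 <= (loss e y * density y)%:E)%E by rewrite lee_fin mulr_ge0.
rewrite -iter_intD//.
apply: (@le_trans _ _ (iter_int p (fun y => \sum_j (H e j y * density y)%:E)%E)).
  apply: le_iter_int.
  - by move=> d' U h mh; apply: emeasurable_funD; [exact: mloss|exact: mC].
  - by move=> d' U h mh; apply: emeasurable_sum => j; exact: mH.
  - by move=> y; exact: (adde_ge0 (l_ge0 y) (C_ge0 y)).
  - move=> y; rewrite sumEFin -EFinD lee_fin -mulrDl -mulr_suml ler_wpM2r//.
    rewrite -lerBrDr (le_trans (loss_bound e _ e0))// /C lerBrDr -big_split.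
    by apply: ler_sum => j _; rewrite /H /= addrAC.
rewrite iter_int_sum//; last first.
  by move=> j y; rewrite lee_fin mulr_ge0//; exact: (H_coord e j e0).1.
rewrite -EFinD -big_split -sumEFin; apply: lee_sum => j _.
apply: (iter_int_density_le R phi phi_ge0 phi_meas phi_int p j) => //.
- by rewrite addr_ge0// ?Cst_ge0// ltW.
- exact: (H_coord e j e0).1.
- exact: measurable_H.
- exact: (H_coord e j e0).2.
Qed.

Let shrink_reg_cvg (y : 'I_p -> R) j :
  shrink_reg n.+1%:R^-1 y j @[n --> \oo] --> estimator d a y j.
Proof.
rewrite /shrink_reg /estimator -/c -/(Q y).
have [Q0|Q0] := eqVneq (Q y) 0.
  (* here the estimator divides by [0], but the shrunk vector [a j * y j] vanishes *)
  suff -> : a j * y j = 0 by rewrite mulr0; under eq_fun do rewrite mulr0; exact: cvg_cst.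
  apply/eqP; rewrite -sqrf_eq0; apply: contraT => aj.
  have : 0 < Q y; last by rewrite Q0 ltxx.
  rewrite /Q (bigD1 j)//= ltr_pwDl ?lt_def ?aj ?sqr_ge0//.
  by apply: sumr_ge0 => k _; exact: sqr_ge0.
apply: cvgB; first exact: cvg_cst.
apply: cvgM; last exact: cvg_cst.
apply: cvgM; first exact: cvg_cst.
apply: cvgV => //; rewrite -[X in _ --> X]addr0.
by apply: cvgD; [exact: cvg_cst|exact: cvg_harmonic].
Qed.

Lemma risk_estimator_le : (risk d (estimator d a) theta <= (\sum_j d j)%:E)%E.
Proof.
pose F (n : nat) y := (loss n.+1%:R^-1 y * density y)%:E.
have e0 (n : nat) : 0 < n.+1%:R^-1 :> R by rewrite invr_gt0.
have F0 n y : (0 <= F n y)%E by rewrite lee_fin mulr_ge0.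
have mF n : coord_measurable _ (F n).
  exact: (coord_measurable_density R phi phi_meas p _ (measurable_loss _ (e0 n))).
have dE (y : nat -> R) : \prod_(j < p) gauss_pdf (theta j) (d j) (y j) = density y.
  by apply: eq_bigr => j _; rewrite phiE.
(* The integrands with [e = 1 / n.+1] converge pointwise everywhere, so the lower limit is the
   integrand of the risk. *)
have -> : risk d (estimator d a) theta = iter_int p (fun y => limn_einf (F ^~ y)).
  congr iter_int; apply/funext => y; apply/esym.
  apply: (cvg_limn_einf_sup _).1.
  apply: cvg_EFin; first by apply: nearW.
  rewrite /comp /=; apply: cvgM.
    apply: cvg_big => [|j _]; first exact: add_continuous.
    apply: (@cvgM _ _ _ _ (fun n => shrink_reg n.+1%:R^-1 (@restr R p y) j - theta j)
      (fun n => shrink_reg n.+1%:R^-1 (@restr R p y) j - theta j)).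
    - by apply: cvgB; [exact: shrink_reg_cvg|exact: cvg_cst].
    - by apply: cvgB; [exact: shrink_reg_cvg|exact: cvg_cst].
  rewrite dE; exact: cvg_cst.
apply: le_trans (iter_int_fatou R p F mF F0) _.
rewrite limn_einf_lim; apply: lime_le; first exact: is_cvg_einfs.
apply: nearW => n; apply: le_trans (risk_shrink_reg _ (e0 n)).
by apply: ereal_inf_lbound; exists n => //=.
Qed.

End Minimaxity.

Theorem theorem2 (R : realType) (p : nat) (d g : 'I_p -> R)
  (hp : (3 <= p)%N)
  (hd : forall j, 0 < d j) (hg : forall j, 0 <= g j)
  (hsort : forall i j : 'I_p, (i <= j)%N ->
     d j ^+ 2 / (d j + g j) <= d i ^+ 2 / (d i + g i)) :
  (exists a, is_solution d g a) /\
  (forall a b, is_solution d g a -> is_solution d g b -> a = b) /\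
  (forall a, is_solution d g a ->
     (exists nu : nat,
        let m := \big[Num.max/0]_(j < p) (d j * a j) in
        let S := \sum_(j < p) d j ^+ 2 / (d j + g j) in
        let T := \sum_(k < p | (k < nu)%N) (d k + g k) / d k ^+ 2 in
        let M := (nu%:R - 2) ^+ 2 / T
                 + \sum_(j < p | (nu <= j)%N) d j ^+ 2 / (d j + g j) in
        let K := Num.sqrt S / Num.sqrt M in
        (3 <= nu <= p)%N /\
            (forall j : 'I_p, (j < nu)%N -> d j * a j = m) /\
            (forall j : 'I_p, (nu <= j)%N -> d j * a j < m) /\
            (forall j : 'I_p, (j < nu)%N -> a j = K * T^-1 * (nu%:R - 2) / d j) /\
            (forall j : 'I_p, (nu <= j)%N -> a j = K * (d j / (d j + g j))) /\
            cstar d a = K * M /\ 0 < cstar d a) /\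
     minimax d (estimator d a)).
Proof.
have [a0 [nu [m [mE [nu3p [h1 [h2 [h3 [h4 [cst [fa [k k0 opt]]]]]]]]]]]] :=
  optimum R p d g hp hd hg hsort.
have sol0 : is_solution d g a0.
  split=> // b /opt H; rewrite -subr_le0 -(pmulr_rle0 _ k0); apply: le_trans H _.
  by rewrite oppr_le0 sumr_ge0// => j _; rewrite mulr_ge0 ?sqr_ge0// addr_ge0// ltW.
(* A second solution has [cstar] at least that of [a0], which forces the weighted sum of squares of
   [b - a0] to be nonpositive. *)
have uniq b : is_solution d g b -> b = a0.
  move=> [fb /(_ a0 fa) ab]; apply/funext => j; apply/eqP; rewrite -subr_eq0.
  have dg i : 0 < d i + g i by rewrite ltr_pwDl.
  have : 0 <= - \sum_(j < p) (d j + g j) * (b j - a0 j) ^+ 2.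
    apply: le_trans (opt b fb); apply: mulr_ge0; first exact: ltW.
    by rewrite subr_ge0.
  apply: contraLR => ba; rewrite oppr_ge0 -ltNge (bigD1 j)//=.
  apply: ltr_pwDl; first by rewrite mulr_gt0// lt_def sqrf_eq0 ba sqr_ge0.
  by apply: sumr_ge0 => i _; rewrite mulr_ge0 ?sqr_ge0// ltW.
split; first by exists a0.
split; first by move=> a b /uniq -> /uniq ->.
move=> a /uniq ->; split; first by exists nu; rewrite -mE; do ![split=> //]; case: cst.
move=> theta; apply: risk_estimator_le => //; first by case: fa.
by case: cst => _ /ltW.
Qed.
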